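(* Let $(A,\mathfrak{m})$ be a short Artin local ring with residue field $k$, and assume $A$ is not a complete intersection. Then there exists an integer $b_A \geq 2$ such that for every finitely generated $A$-module $M$ with $\operatorname{curv}(M) < \operatorname{curv}(k)$, $b_A$ divides $\ell(\Omega^i_A(M))$ for all $i \geq 1$.
   Context: A local ring is short if $\mathfrak{m}^3 = 0$ and $\mathfrak{m}^2 \neq 0$. For a module $M$, $\beta_n(M) = \ell(\operatorname{Tor}^A_n(M,k))$ and $\operatorname{curv}(M) = \limsup_{n\to\infty} \sqrt[n]{\beta_n(M)}$. $\Omega^i_A(M)$ denotes the $i$-th syzygy of $M$ in a minimal free resolution. *)

(* Defs.v *)
From HB Require Import structures.
From mathcomp Require Import all_boot all_order all_algebra.
From mathcomp Require Import all_classical all_reals all_analysis.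
From mathcomp Require Import Rstruct Rstruct_topology.
From Stdlib Require Import Reals.

Set Implicit Arguments.
Unset Strict Implicit.
Unset Printing Implicit Defensive.

Import Order.TTheory GRing.Theory Num.Theory.
Local Open Scope ring_scope.

Section CommAlg.
Variable A : comUnitRingType.

Definition is_submod (V : lmodType A) (S : V -> Prop) : Prop :=
  S 0 /\ forall (a : A) (x y : V), S x -> S y -> S (a *: x + y).

Definition comb (V : lmodType A) (m : nat) (x : 'rV[A]_m) (g : 'I_m -> V) : V :=
  \sum_(j < m) x 0 j *: g j.

(* The module S/N (N <= S submodules of V) is generated by the images of g. *)
Definition generates (V : lmodType A) (S N : V -> Prop) (m : nat)
    (g : 'I_m -> V) : Prop :=
  (forall j, S (g j)) /\
  (forall v, S v -> exists x : 'rV[A]_m, N (v - comb x g)).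

Definition mingens (V : lmodType A) (S N : V -> Prop) (m : nat) : Prop :=
  (exists g : 'I_m -> V, generates S N g) /\
  (forall (m' : nat) (g' : 'I_m' -> V), generates S N g' -> (leq m m')).

(* One step of a MINIMAL free resolution of S/N: F = A^m -> S/N is given by a
   minimal generating family g (m = mu(S/N)), and K is its kernel (the first
   syzygy module, a submodule of A^m = 'rV_m). *)
Definition syz_step (V : lmodType A) (S N : V -> Prop) (m : nat)
    (K : 'rV[A]_m -> Prop) : Prop :=
  mingens S N m /\
  exists g : 'I_m -> V, generates S N g /\
    (forall x : 'rV[A]_m, K x <-> N (comb x g)).

(* A minimal free resolution of the module S/N:
     ... -> A^(n 2) -> A^(n 1) -> A^(n 0) -> S/N -> 0,
   so that beta_i(S/N) = n i and Omega^(i+1)(S/N) = Om i (a submodule of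
   A^(n i)). *)
Definition min_resolution (V : lmodType A) (S N : V -> Prop) (n : nat -> nat)
    (Om : forall i, 'rV[A]_(n i) -> Prop) : Prop :=
  syz_step S N (Om 0%N) /\
  forall i : nat, syz_step (Om i) (fun x => x = 0) (Om i.+1).

Definition strict_chain (V : lmodType A) (S : V -> Prop) (T : nat -> V -> Prop)
    (l : nat) : Prop :=
  (forall j, (leq j l) -> is_submod (T j) /\ (forall v, T j v -> S v)) /\
  (forall j, (ltn j l) ->
     (forall v, T j v -> T j.+1 v) /\ exists v, T j.+1 v /\ ~ T j v).

Definition has_length (V : lmodType A) (S : V -> Prop) (l : nat) : Prop :=
  (exists T, strict_chain S T l) /\ (forall T, ~ strict_chain S T l.+1).

Definition maxid (x : A) : Prop := x \isn't a GRing.unit.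

Definition is_local : Prop :=
  forall x y : A, maxid x -> maxid y -> maxid (x + y).

Definition artin_local : Prop :=
  is_local /\ exists l, has_length (fun _ : A^o => True) l.

Definition short_ring : Prop :=
  (forall x y z : A, maxid x -> maxid y -> maxid z -> x * y * z = 0) /\
  (exists x y : A, maxid x /\ maxid y /\ x * y <> 0).

End CommAlg.

Section Ideals.
Variable Q : comUnitRingType.

Definition is_ideal (I : Q -> Prop) : Prop :=
  I 0 /\ forall a x y : Q, I x -> I y -> I (a * x + y).

Definition gen_ideal (c : nat) (f : 'I_c -> Q) (x : Q) : Prop :=
  exists r : 'I_c -> Q, x = \sum_(j < c) r j * f j.

Definition gen_ideal_first (c : nat) (f : 'I_c -> Q) (i : nat) (x : Q) : Prop :=
  exists r : 'I_c -> Q, x = \sum_(j < c | (ltn j i)) r j * f j.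

Definition noetherian : Prop :=
  forall I : Q -> Prop, is_ideal I ->
    exists (c : nat) (f : 'I_c -> Q), forall x, I x <-> gen_ideal f x.

Definition is_prime (P : Q -> Prop) : Prop :=
  is_ideal P /\ ~ P 1 /\ forall x y, P (x * y) -> P x \/ P y.

Definition prime_chain (P : nat -> Q -> Prop) (d : nat) : Prop :=
  (forall j, (leq j d) -> is_prime (P j)) /\
  (forall j, (ltn j d) ->
     (forall x, P j x -> P j.+1 x) /\ exists x, P j.+1 x /\ ~ P j x).

Definition krull_dim (d : nat) : Prop :=
  (exists P, prime_chain P d) /\ (forall P, ~ prime_chain P d.+1).

Definition maxid_mingens (d : nat) : Prop :=
  (exists f : 'I_d -> Q, forall x, maxid x <-> gen_ideal f x) /\
  (forall (d' : nat) (f : 'I_d' -> Q),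
     (forall x, maxid x <-> gen_ideal f x) -> (leq d d')).

Definition regular_local : Prop :=
  is_local Q /\ noetherian /\ exists d, krull_dim d /\ maxid_mingens d.

Definition regular_seq (c : nat) (f : 'I_c -> Q) : Prop :=
  (forall i, maxid (f i)) /\
  (forall (i : 'I_c) (y : Q),
     gen_ideal_first f i (f i * y) -> gen_ideal_first f i y).

End Ideals.

(* A (Artin, hence complete) local ring is a complete intersection if it is a
   quotient of a regular local ring by an ideal generated by a regular
   sequence. *)
Definition complete_intersection (A : comUnitRingType) : Prop :=
  exists (Q : comUnitRingType) (phi : {rmorphism Q -> A}) (c : nat)
         (f : 'I_c -> Q),
    regular_local Q /\ regular_seq f /\ (forall a : A, exists q, phi q = a) /\
    (forall q, phi q = 0 <-> gen_ideal f q).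

Definition curv (beta : nat -> nat) : \bar R :=
  limn_esup (fun n : nat => (((beta n)%:R : R) `^ (n%:R^-1))%:E).

(* Main.v *)
(** Let [e = l(m/m^2)] and [r = l(m^2)], and let [b_i] be the Betti numbers of [M].
Since [m^3 = 0], the syzygies [Omega^(i+2)] contain [m^2 F_(i+1)].  If
[m Omega^(i+2)] were smaller than [m^2 F_(i+1)], the residue field [k] would be
a direct summand of [Omega^(i+2)] and [curv k <= curv M].  Hence equality holds,
which gives [l(Omega^(i+1)) = (1 + e) b_(i+1) - b_(i+2)] and the recurrence
[u_(i+2) = e u_(i+1) - r u_i] for [u_i = b_(i+1)].  Comparing the minimal
resolution of [S/mS] with the mapping cone attached to [0 -> mS -> S -> S/mS -> 0]
for [S = Omega^(i+2)] yields [u_(i+1) b_(j+1)(k) <= u_(i+j+2) + r u_i b_j(k)].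
As [M] grows more slowly than [k], this forces [u] to be geometric with integral
ratio [a], the smaller root of [X^2 - e X + r]; so [l(Omega^(i+1)) = (1 + e - a) u_i],
and [1 + e - a] depends on [A] only. *)

Require Import Defs.
From HB Require Import structures.
From mathcomp Require Import all_boot all_order all_algebra.
From mathcomp Require Import all_classical all_reals all_analysis.
From mathcomp Require Import Rstruct Rstruct_topology.
From mathcomp Require Import fingroup perm ring lra zify.
Set Implicit Arguments.
Unset Strict Implicit.
Unset Printing Implicit Defensive.
Import Order.TTheory GRing.Theory Num.Theory.
Local Open Scope ring_scope.

(** * Composition series *)

Section Submodules.
Variables (A : comUnitRingType) (V : lmodType A).
Implicit Types (S N T : V -> Prop).

Lemma submod0 S : is_submod S -> S 0.
Proof. by case. Qed.

Lemma submodZ S a v : is_submod S -> S v -> S (a *: v).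
Proof. by move=> [S0 SD] Sv; rewrite -[_ *: _]addr0; apply: SD. Qed.

Lemma submodD S v w : is_submod S -> S v -> S w -> S (v + w).
Proof. by move=> [S0 SD] Sv Sw; rewrite -[v]scale1r; apply: SD. Qed.

Lemma submodN S v : is_submod S -> S v -> S (- v).
Proof. by move=> hS Sv; rewrite -scaleN1r; apply: submodZ. Qed.

Lemma submodB S v w : is_submod S -> S v -> S w -> S (v - w).
Proof. by move=> hS Sv Sw; apply: submodD => //; apply: submodN. Qed.

Lemma submod_sum S (I : Type) (r : seq I) (P : pred I) (F : I -> V) :
  is_submod S -> (forall i, P i -> S (F i)) -> S (\sum_(i <- r | P i) F i).
Proof.
move=> hS hF; apply: (big_ind S) => //; first exact: submod0.
by move=> v w; apply: submodD.
Qed.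

Lemma submod_comb S m (x : 'rV[A]_m) (g : 'I_m -> V) :
  is_submod S -> (forall j, S (g j)) -> S (comb x g).
Proof. by move=> hS hg; apply: submod_sum => // j _; apply: submodZ. Qed.

Lemma combB m (x y : 'rV[A]_m) (g : 'I_m -> V) :
  comb (x - y) g = comb x g - comb y g.
Proof.
by rewrite /comb -sumrB; apply: eq_bigr => j _; rewrite !mxE scalerBl.
Qed.

Lemma combD m (x y : 'rV[A]_m) (g : 'I_m -> V) :
  comb (x + y) g = comb x g + comb y g.
Proof.
by rewrite /comb -big_split; apply: eq_bigr => j _; rewrite !mxE scalerDl.
Qed.

Lemma combZ a m (x : 'rV[A]_m) (g : 'I_m -> V) :
  comb (a *: x) g = a *: comb x g.
Proof.
by rewrite /comb scaler_sumr; apply: eq_bigr => j _; rewrite !mxE scalerA.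
Qed.

Lemma comb0 m (g : 'I_m -> V) : comb 0 g = 0.
Proof. by rewrite /comb big1 // => j _; rewrite mxE scale0r. Qed.

Lemma comb_delta m (j : 'I_m) (g : 'I_m -> V) : comb (delta_mx 0 j) g = g j.
Proof.
rewrite /comb (bigD1 j) //= mxE !eqxx scale1r big1 ?addr0 // => i ij.
by rewrite mxE eqxx (negbTE ij) scale0r.
Qed.

Lemma is_submod0 : is_submod (fun v : V => v = 0).
Proof. by split=> // a x y -> ->; rewrite scaler0 addr0. Qed.

Lemma is_submodT : is_submod (fun _ : V => True).
Proof. by []. Qed.

(** Expresses that S'/S is a copy of the residue field without forming a quotient module. *)
Definition covers S S' : Prop :=
  [/\ is_submod S, is_submod S', forall v, S v -> S' v &
   exists v, [/\ S' v, ~ S v, forall w, S' w -> exists a, S (w - a *: v) &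
              forall x, maxid x -> S (x *: v)]].

(* [clen N S l]: the module [S / N] has a composition series of length [l]. *)
Inductive clen N : (V -> Prop) -> nat -> Prop :=
| clen0 : is_submod N -> clen N N 0
| clenS S S' l : clen N S l -> covers S S' -> clen N S' l.+1.

Lemma clen_submodl N S l : clen N S l -> is_submod N.
Proof. by elim. Qed.

Lemma clen_submodr N S l : clen N S l -> is_submod S.
Proof. by case=> // S1 S' l' _ []. Qed.

Lemma clen_sub N S l : clen N S l -> forall v, N v -> S v.
Proof. by elim=> // S1 S' l' _ IH [_ _ h _] v /IH /h. Qed.

Lemma clen_trans N S T l l' : clen N S l -> clen S T l' -> clen N T (l + l').
Proof.
move=> h; elim=> [_|S1 S' k _ IH hc]; first by rewrite addn0.
by rewrite addnS; apply: clenS hc.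
Qed.

Lemma covers_clen S S' : covers S S' -> clen S S' 1.
Proof. by move=> h; apply: (clenS _ h); apply: clen0; case: h. Qed.

(* The measure of [T] counts the factors of the composition series that [T]
   meets; this is what makes every strict chain at most as long. *)
Lemma clen_measure N S l : clen N S l ->
  exists d : (V -> Prop) -> nat,
    (forall T, (d T <= l)%N) /\
    forall T T', is_submod T -> is_submod T' -> (forall v, N v -> T v) ->
      (forall v, T v -> T' v) -> (forall v, T' v -> S v) ->
      (exists v, T' v /\ ~ T v) -> (d T < d T')%N.
Proof.
elim=> [hN|S1 S' k h1 [d [dle dlt]] [hS1 hS' sub [v [S'v nSv gen mv]]]].
  exists (fun _ => 0%N); split=> // T T' _ _ NT _ T'N [v [T'v nTv]].
  by case: nTv; apply/NT/T'N.
(* [cap] is the trace below the top factor, and [ind] records whether the submodule meets that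
   factor. *)
pose cap T w := T w /\ S1 w.
pose ind T := `[< exists w, T w /\ (S' w /\ ~ S1 w) >].
have capM T : is_submod T -> is_submod (cap T).
  move=> [T0 TD]; case: (hS1) => S0 SD; split; first by split.
  by move=> a x y [Tx Sx] [Ty Sy]; split; [apply: TD | apply: SD].
exists (fun T => (d (cap T) + ind T)%N).
split=> [T|T T' hT hT' NT TT' T'S' [w [T'w nTw]]].
  by rewrite -addn1 leq_add // leq_b1.
have indle : (ind T <= ind T')%N.
  rewrite /ind; case: asboolP => // -[t [Tt St]].
  by case: asboolP => // -[]; exists t; split=> //; apply: TT'.
have [[u [[T'u S1u] nTu]]|nex] := pselect (exists u, cap T' u /\ ~ cap T u).
  rewrite -addSn leq_add // dlt //; try exact: capM.
  - by move=> z Nz; split; [apply: NT | apply: (clen_sub h1)].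
  - by move=> z [Tz Sz]; split=> //; apply: TT'.
  - by move=> z [].
  - by exists u.
(* With equal traces, the extra element [w] lies outside [S1], so [T'] meets the top factor; it
   remains to see that [T] does not. *)
have capE : cap T = cap T'.
  apply/predeqP => z; split=> [[Tz Sz]|[T'z Sz]]; first by split=> //; apply: TT'.
  by apply: contrapT => nz; apply: nex; exists z.
have nS1w : ~ S1 w.
  move=> S1w; have : cap T' w by [].
  by rewrite -capE => -[].
rewrite capE -addnS leq_add2l /ind.
case: asboolP => [[t [Tt [S't nS1t]]]|_]; last first.
  by case: asboolP => // -[]; exists w; split=> //; split=> //; apply: T'S'.
(* Modulo [S1], both [t] and [w] are multiples of [v], the first one by a unit. Hence [w] minus a
   multiple of [t] lies in the common trace, which puts [w] in [T]. *)
exfalso; have [a Sa] := gen _ S't; have [b Sb] := gen _ (T'S' _ T'w).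
have ua : a \is a GRing.unit.
  apply: contrapT => /negP na; apply: nS1t; rewrite -[t](subrK (a *: v)).
  by apply: submodD => //; apply: mv.
have S1c : S1 (w - (b / a) *: t).
  have -> : w - (b / a) *: t = (w - b *: v) - (b / a) *: (t - a *: v).
    by rewrite scalerBr scalerA divrK // opprB addrA subrK.
  by apply: submodB => //; apply: submodZ.
have : cap T' (w - (b / a) *: t).
  by split=> //; apply: submodB => //; apply: submodZ => //; apply: TT'.
rewrite -capE => -[Tc _]; apply: nTw; rewrite -[w](subrK ((b / a) *: t)).
by apply: submodD => //; apply: submodZ.
Qed.

(** The terms of the second series increase strictly between [N] and [S], so the measure attached to
    the first series grows at each of them. *)
Lemma clen_le N S l N' S' l' : clen N S l -> clen N' S' l' ->
  (forall v, N v -> N' v) -> (forall v, S' v -> S v) -> (l' <= l)%N.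
Proof.
move=> /clen_measure [d [dle dlt]] h NN' S'S.
apply: leq_trans (dle S').
elim: h S'S => // S1 S2 k h1 IH [hS1 hS2 sub [v [S2v nSv _ _]]] S2S.
apply: leq_ltn_trans (IH _) (dlt _ _ _ _ _ _ _ _) => //.
- by move=> w /sub /S2S.
- by move=> w /NN'; apply: (clen_sub h1).
- by exists v.
Qed.

Lemma clen_uniq N S l l' : clen N S l -> clen N S l' -> l = l'.
Proof.
by move=> h h'; apply/eqP; rewrite eqn_leq (clen_le h h') ?(clen_le h' h).
Qed.

Lemma clen_chain S l : clen (fun v => v = 0) S l ->
  exists T : nat -> V -> Prop, strict_chain S T l.
Proof.
elim=> [h0|S1 S' k h [T [T1 T2]] [hS1 hS' sub [v [S'v nSv _ _]]]].
  by exists (fun _ v => v = 0); split.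
exists (fun j => if (j <= k)%N then T j else S'); split=> j.
  by move=> jk; case: ifP => // /T1 [? TS]; split=> // w /TS /sub.
rewrite /= ltnS => jk; rewrite jk; case: ltnP => [/T2 //|kj].
have ejk : j = k by apply/eqP; rewrite eqn_leq jk.
have [_ TS] := T1 _ jk; split=> [w /TS /sub //|].
by exists v; split=> // /TS.
Qed.

Lemma clen_has_length S l : clen (fun v => v = 0) S l -> has_length S l.
Proof.
move=> h; split; first exact: clen_chain.
move=> T [T1 T2]; have [d [dle dlt]] := clen_measure h.
suff hd j : (j <= l.+1)%N -> (j <= d (T j))%N.
  by have := leq_trans (hd _ (leqnn _)) (dle _); rewrite ltnn.
elim: j => // j IH jl; apply: leq_ltn_trans (IH (ltnW jl)) _.
have [hj _] := T1 _ (ltnW jl); have [hj' TS] := T1 _ jl.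
have [TT ex] := T2 _ jl.
by apply: dlt => // v ->; apply: submod0.
Qed.

Definition adjoin S (v : V) w : Prop := exists a : A, S (w - a *: v).

Lemma covers_adjoin S v : is_submod S -> ~ S v ->
  (forall x, maxid x -> S (x *: v)) -> covers S (adjoin S v).
Proof.
move=> hS nSv mv; have sub w : S w -> adjoin S v w.
  by exists 0; rewrite scale0r subr0.
split=> //.
  split; first by apply: sub; apply: submod0.
  move=> a x y [b Sb] [c Sc]; exists (a * b + c).
  have -> : a *: x + y - (a * b + c) *: v = a *: (x - b *: v) + (y - c *: v).
    by rewrite scalerBr scalerA scalerDl opprD addrACA.
  by apply: submodD => //; apply: submodZ.
exists v; split=> //; exists 1; rewrite scale1r subrr; exact: submod0.
Qed.

Lemma adjoin_sub S S' v : is_submod S' -> (forall w, S w -> S' w) -> S' v ->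
  forall w, adjoin S v w -> S' w.
Proof.
move=> hS' sub S'v w [a /sub Sa]; rewrite -[w](subrK (a *: v)).
by apply: submodD => //; apply: submodZ.
Qed.

(* As [m^3 = 0], multiplying [v] by elements of [m] as long as it stays outside
   [S] ends in the socle of the quotient after at most two steps. *)
Lemma short_socle S S' :
  (forall x y z : A, maxid x -> maxid y -> maxid z -> x * y * z = 0) ->
  is_submod S -> is_submod S' -> (exists v, S' v /\ ~ S v) ->
  exists v, [/\ S' v, ~ S v & forall x, maxid x -> S (x *: v)].
Proof.
move=> m3 hS hS'.
have step v : S' v -> ~ S v ->
    (exists v, [/\ S' v, ~ S v & forall x, maxid x -> S (x *: v)]) \/
    exists2 x, maxid x & S' (x *: v) /\ ~ S (x *: v).
  move=> S'v nSv.
  have [h|/existsNP [x /not_implyP [mx nx]]] :=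
    pselect (forall x, maxid x -> S (x *: v)).
    by left; exists v.
  by right; exists x => //; split=> //; apply: submodZ.
case=> v [S'v nSv].
have [//|[x mx [S'x nSx]]] := step _ S'v nSv.
have [//|[y my [S'y nSy]]] := step _ S'x nSx.
have [//|[z mz [_ nSz]]] := step _ S'y nSy.
by case: nSz; rewrite !scalerA m3 // scale0r; apply: submod0.
Qed.

(** Adjoining a socle element of the quotient lengthens a series that starts at [N]; the bound [B]
    forces this process to reach [S]. *)
Lemma clen_exists N S B :
  (forall x y z : A, maxid x -> maxid y -> maxid z -> x * y * z = 0) ->
  is_submod N -> is_submod S -> (forall v, N v -> S v) ->
  (forall S' l, clen N S' l -> (forall v, S' v -> S v) -> (l <= B)%N) ->
  exists l, clen N S l.
Proof.
move=> m3 hN hS NS bd.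
have grow n : (exists l, clen N S l) \/
    exists2 S', clen N S' n & forall v, S' v -> S v.
  elim: n => [|n [|[S' h S'S]]]; [|by left|].
    by right; exists N => //; apply: clen0.
  have [ex|nex] := pselect (exists v, S v /\ ~ S' v).
    have [v [Sv nv mv]] := short_socle m3 (clen_submodr h) hS ex.
    right; exists (adjoin S' v); last exact: adjoin_sub.
    by apply: (clenS h); apply: covers_adjoin => //; apply: clen_submodr h.
  left; exists n; suff <- : S' = S by [].
  apply/predeqP => v; split=> [/S'S //|Sv].
  by apply: contrapT => nv; apply: nex; exists v.
by have [//|[S' h /(bd _ _ h)]] := grow B.+1; rewrite ltnn.
Qed.

Lemma clen_between N S N' S' l :
  (forall x y z : A, maxid x -> maxid y -> maxid z -> x * y * z = 0) ->
  clen N S l -> is_submod N' -> is_submod S' -> (forall v, N v -> N' v) ->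
  (forall v, N' v -> S' v) -> (forall v, S' v -> S v) ->
  exists l', clen N' S' l'.
Proof.
move=> m3 h hN' hS' NN N'S' S'S; apply: (@clen_exists _ _ l) => // T k hT TS.
by apply: clen_le h hT NN _ => v /TS /S'S.
Qed.

(** The series consists of [N] plus the span of the first [t] elements; independence modulo the
    maximal ideal keeps the inclusions strict. *)
Lemma clen_basis N m (g : 'I_m -> V) : is_submod N ->
  (forall x j, maxid x -> N (x *: g j)) ->
  (forall x, N (comb x g) -> forall j, maxid (x 0 j)) ->
  clen N (fun v => exists x, N (v - comb x g)) m.
Proof.
move=> hN mg ind.
pose T t v := exists x : 'rV[A]_m,
  (forall j : 'I_m, (t <= j)%N -> x 0 j = 0) /\ N (v - comb x g).
have hT t : is_submod (T t).
  split; first by exists 0; split=> [j _|]; rewrite ?mxE // comb0 subr0; apply: submod0.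
  move=> a v w [x [x0 Nx]] [y [y0 Ny]]; exists (a *: x + y); split=> [j tj|].
    by rewrite !mxE x0 // y0 // mulr0 addr0.
  rewrite combD combZ opprD addrACA -scalerBr.
  by apply: submodD => //; apply: submodZ.
have NT t v : N v -> T t v.
  by move=> Nv; exists 0; split=> [j _|]; rewrite ?mxE // comb0 subr0.
have cT t : (t <= m)%N -> clen N (T t) t.
  elim: t => [_|t IH tm].
    suff -> : T 0%N = N by apply: clen0.
    apply/predeqP => v; split=> [[x [x0 Nx]]|]; last exact: NT.
    suff x00 : x = 0 by move: Nx; rewrite x00 comb0 subr0.
    by apply/rowP => j; rewrite x0 // mxE.
  apply: clenS (IH (ltnW tm)) _; pose t' := Ordinal tm.
  split=> // [v [x [x0 Nx]]|].
    by exists x; split=> // j tj; apply: x0; apply: ltnW.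
  exists (g t'); split.
  - exists (delta_mx 0 t'); split; last by rewrite comb_delta subrr; apply: submod0.
    move=> j tj; rewrite mxE eqxx /= -val_eqE /=; case: eqP => // jt.
    by move: tj; rewrite jt ltnn.
  (* Membership would give a relation modulo [N] with coefficient 1 at [t'], where [x] vanishes. *)
  - case=> x [x0]; rewrite -(comb_delta t' g) -combB => /ind /(_ t').
    by rewrite !mxE !eqxx x0 // subr0 /maxid unitr1.
  - move=> w [x [x0 Nx]]; exists (x 0 t'), (x - x 0 t' *: delta_mx 0 t').
    split; last by rewrite combB combZ comb_delta opprB addrA subrK.
    move=> j; rewrite leq_eqVlt => /orP [/eqP tj|tj].
      have -> : j = t' by apply/val_inj.
      by rewrite !mxE !eqxx mulr1 subrr.
    rewrite !mxE (x0 _ tj) -val_eqE /=; case: eqP => [jt|_].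
      by move: tj; rewrite jt ltnn.
    by rewrite mulr0 subr0.
  - by move=> x mx; apply: NT; apply: mg.
suff <- : T m = (fun v => exists x, N (v - comb x g)) by apply: cT.
apply/predeqP => v; split=> [[x [_ Nx]]|[x Nx]]; first by exists x.
by exists x; split=> // j; rewrite leqNgt ltn_ord.
Qed.

(** Converse of [clen_basis]: a quotient killed by the maximal ideal is a vector space, and lifting
    a generator of each composition factor gives a basis. *)
Lemma clen_get_basis N S l : clen N S l ->
  (forall x v, maxid x -> S v -> N (x *: v)) ->
  exists g : 'I_l -> V, [/\ forall j, S (g j),
     forall v, S v -> exists x, N (v - comb x g) &
     forall x, N (comb x g) -> forall j, maxid (x 0 j)].
Proof.
elim=> [hN _|S1 S' k h IH [hS1 hS' sub [v [S'v nSv gen mv]]] mS'].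
  exists (fun _ => 0); split=> [j|v Nv|x _ []//]; first exact: submod0.
  by exists 0; rewrite comb0 subr0.
have hN := clen_submodl h.
have [|g [Sg geng ind]] := IH; first by move=> x w mx /sub; apply: mS'.
pose g' j := if unlift ord_max j is Some i then g i else v.
have combE (x : 'rV[A]_k.+1) :
    comb x g' = comb (\row_j x 0 (lift ord_max j)) g + x 0 ord_max *: v.
  rewrite /comb big_ord_recr /= /g' unlift_none; congr (_ + _).
  apply: eq_bigr => j _.
  have -> : widen_ord (leqnSn k) j = lift ord_max j.
    by apply/val_inj; rewrite /= /bump leqNgt ltn_ord.
  by rewrite liftK mxE.
exists g'; split.
- by move=> j; rewrite /g'; case: unliftP => [i _|_] //; apply/sub/Sg.
- move=> w /gen [a /geng [x Nx]].
  exists (\row_j (if unlift ord_max j is Some i then x 0 i else a)).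
  rewrite combE mxE unlift_none opprD addrA addrAC.
  suff -> : \row_j (\row_j (if unlift ord_max j is Some i then x 0 i else a)) 0
       (lift ord_max j) = x by [].
  by apply/rowP => j; rewrite !mxE liftK.
- move=> x; rewrite combE => Nx.
  (* A unit as last coefficient would put [v] in [S1]. A nonunit multiple of [v] lies in [N], which
     leaves a relation among the earlier elements. *)
  have S1g y : S1 (comb y g) by apply: submod_comb => //; apply: clen_submodr h.
  have S1x : S1 (x 0 ord_max *: v).
    rewrite -[_ *: v](addrK (comb (\row_j x 0 (lift ord_max j)) g)).
    by apply: submodB => //; rewrite addrC; apply: clen_sub h _ Nx.
  have mx : maxid (x 0 ord_max).
    apply/negP => ux; apply: nSv; rewrite -[v]scale1r -(mulVr ux) -scalerA.
    exact: submodZ.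
  have Nx' : N (comb (\row_j x 0 (lift ord_max j)) g).
    rewrite -[comb _ _](addrK (x 0 ord_max *: v)).
    by apply: submodB => //; apply: mS'.
  move=> j; case: (unliftP ord_max j) => [i ->|-> //].
  by have := ind _ Nx' i; rewrite mxE.
Qed.

End Submodules.

(** * Lengths of images and of submodules of free modules *)

(** The part of the kernel inside [S] lies in [N], so strict inclusions above [N] stay strict under
    [f]. *)
Lemma clen_image (A : comUnitRingType) (V W : lmodType A) (f : {linear V -> W})
    (N S : V -> Prop) l : clen N S l ->
  (forall v, S v -> f v = 0 -> N v) ->
  clen (fun w => exists2 v, N v & f v = w) (fun w => exists2 v, S v & f v = w) l.
Proof.
have imS (T : V -> Prop) : is_submod T -> is_submod (fun w => exists2 v, T v & f v = w).
  move=> hT; split; first by exists 0; [apply: submod0|rewrite linear0].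
  move=> a x y [v Tv <-] [w Tw <-]; exists (a *: v + w); last by rewrite linearP.
  by apply: submodD => //; apply: submodZ.
elim=> [hN _|S1 S' k h IH [hS1 hS' sub [v [S'v nSv gen mv]]] ker].
  by apply: clen0; apply: imS.
apply: clenS (IH _) _; first by move=> v' /sub; apply: ker.
split; [exact: imS|exact: imS|by move=> w [u /sub Su <-]; exists u|].
exists (f v); split.
- by exists v.
- case=> u Su fu; apply: nSv; rewrite -[v](subrK u); apply: submodD => //.
  apply: clen_sub h _ _; apply: ker; last by rewrite linearB fu subrr.
  by apply: submodB => //; apply: sub.
- by move=> w [u /gen [a Sa] <-]; exists a, (u - a *: v) => //; rewrite linearB linearZ.
- by move=> x mx; exists (x *: v); rewrite ?linearZ //; apply: mv.
Qed.

(** For an ideal I this is the submodule I F of the free module F = A^n. *)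
Definition cw (A : comUnitRingType) n (I : A -> Prop) (x : 'rV[A]_n) : Prop :=
  forall j, I (x 0 j).

Lemma is_submod_cw (A : comUnitRingType) n (I : A -> Prop) :
  is_submod (V := A^o) I -> is_submod (@cw A n I).
Proof.
move=> [I0 ID]; split=> [j|a x y Ix Iy j]; rewrite !mxE //.
exact: ID.
Qed.

(** Enlarging the coordinates from I to J one at a time gives n factors, each a copy of J/I. *)
Lemma covers_cw (A : comUnitRingType) n (I J : A -> Prop) :
  covers (V := A^o) I J -> clen (@cw A n I) (@cw A n J) n.
Proof.
move=> [hI hJ sub [v [Jv nIv gen mv]]].
pose W t (x : 'rV[A]_n) :=
  (forall j : 'I_n, J (x 0 j)) /\ (forall j : 'I_n, (t <= j)%N -> I (x 0 j)).
have hW t : is_submod (W t).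
  case: hI hJ => I0 ID [J0 JD]; split; first by split=> j; rewrite mxE.
  move=> a x y [Jx Ix] [Jy Iy]; split=> j; rewrite !mxE.
    exact: JD.
  by move=> tj; apply: ID; auto.
have cW t : (t <= n)%N -> clen (@cw A n I) (W t) t.
  elim: t => [_|t IH tn].
    suff -> : W 0%N = @cw A n I by apply/clen0/is_submod_cw.
    apply/predeqP => x; split=> [[_ h] j|h]; first exact: h.
    by split=> j => [|_]; [apply/sub/h|apply: h].
  apply: clenS (IH (ltnW tn)) _; pose t' := Ordinal tn.
  split=> // [x [Jx Ix]|].
    by split=> // j tj; apply: Ix; apply: ltnW.
  have dE j : (v *: delta_mx 0 t' : 'rV[A]_n) 0 j = if j == t' then v else 0.
    by rewrite !mxE eqxx /=; case: eqP; rewrite ?mulr1 ?mulr0.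
  exists (v *: delta_mx 0 t'); split.
  - split=> j; rewrite dE; case: eqP => // jt; try by apply: (submod0 hJ).
      by rewrite jt ltnn.
    by move=> _; apply: (submod0 hI).
  - by case=> _ /(_ t' (leqnn _)); rewrite dE eqxx.
  - move=> x [Jx Ix]; have [a Ia] := gen _ (Jx t'); exists a.
    have eE j : (x - a *: (v *: delta_mx 0 t')) 0 j =
        x 0 j - (if j == t' then a * v else 0).
      rewrite mxE [in X in _ + X]mxE [in X in _ - X]mxE dE.
      by case: eqP; rewrite ?mulr0.
    split=> j; rewrite eE; case: eqP => [->|/eqP jt]; rewrite ?subr0 //.
    + by apply: sub.
    + rewrite leq_eqVlt => /orP [/eqP tj|/Ix //].
      by case/eqP: jt; apply/val_inj.
  - move=> x mx; have eE j : (x *: (v *: delta_mx 0 t') : 'rV[A]_n) 0 j =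
        if j == t' then x * v else 0.
      by rewrite mxE dE; case: eqP; rewrite ?mulr0.
    have Iv j : I ((x *: (v *: delta_mx 0 t') : 'rV[A]_n) 0 j).
      by rewrite eE; case: eqP => _; [apply: mv|apply: (submod0 hI)].
    by split=> j // ; apply: sub.
suff <- : W n = @cw A n J by apply: cW.
apply/predeqP => x; split=> [[h _] //|h]; split=> // j.
by rewrite leqNgt ltn_ord.
Qed.

Lemma clen_cw (A : comUnitRingType) n (I J : A -> Prop) l :
  clen (V := A^o) I J l -> clen (@cw A n I) (@cw A n J) (l * n).
Proof.
elim=> [hI|S S' k h IH hc]; first by apply/clen0/is_submod_cw.
by rewrite mulSnr; apply: clen_trans IH _; apply: covers_cw.
Qed.

(** * Minimal complexes of free modules *)

Section Complexes.
Variables (A : comUnitRingType) (hloc : is_local A).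

Definition mmx m n (X : 'M[A]_(m, n)) : Prop := forall i j, maxid (X i j).

Lemma maxid0 : maxid (0 : A).
Proof. by rewrite /maxid unitr0. Qed.

Lemma maxidM (a x : A) : maxid x -> maxid (a * x).
Proof. by rewrite /maxid unitrM => /negbTE ->; rewrite andbF. Qed.

Lemma maxid_submod : is_submod (V := A^o) (@maxid A).
Proof. by split=> [|a x y mx my]; [exact: maxid0|apply: hloc => //; apply: maxidM]. Qed.

Lemma maxid1B (x : A) : maxid x -> maxid (1 - x) -> False.
Proof.
by move=> mx /(hloc mx); rewrite addrC subrK /maxid unitr1.
Qed.

Lemma maxid_sum (I : Type) (r : seq I) (P : pred I) (F : I -> A) :
  (forall i, P i -> maxid (F i)) -> maxid (\sum_(i <- r | P i) F i).
Proof. by move=> hF; apply: (submod_sum (V := A^o)) => //; apply: maxid_submod. Qed.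

Lemma mmx_mull m n p (X : 'M[A]_(m, n)) (Y : 'M[A]_(n, p)) :
  mmx Y -> mmx (X *m Y).
Proof. by move=> hY i j; rewrite mxE; apply: maxid_sum => k _; apply: maxidM. Qed.

Lemma mmx_mulr m n p (X : 'M[A]_(m, n)) (Y : 'M[A]_(n, p)) :
  mmx X -> mmx (X *m Y).
Proof.
by move=> hX i j; rewrite mxE; apply: maxid_sum => k _; rewrite mulrC; apply: maxidM.
Qed.

Lemma mmxD m n (X Y : 'M[A]_(m, n)) : mmx X -> mmx Y -> mmx (X + Y).
Proof. by move=> hX hY i j; rewrite mxE; apply: hloc. Qed.

Lemma mmx0 m n : mmx (0 : 'M[A]_(m, n)).
Proof. by move=> i j; rewrite mxE; apply: maxid0. Qed.

Lemma mmx_row m n (X : 'M[A]_(m, n)) i : mmx X -> cw (@maxid A) (row i X).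
Proof. by move=> hX j; rewrite mxE. Qed.

Lemma maxid_prod1 (I : Type) (r : seq I) (F : I -> A) :
  (forall i, maxid (F i - 1)) -> maxid (\prod_(i <- r) F i - 1).
Proof.
move=> hF; elim: r => [|i r IH]; first by rewrite big_nil subrr; apply: maxid0.
rewrite big_cons; set p := \prod_(_ <- r) _ in IH *.
have -> : F i * p - 1 = p * (F i - 1) + (p - 1) by ring.
by apply: hloc => //; apply: maxidM.
Qed.

(** In the Leibniz formula the identity permutation contributes 1 modulo the maximal ideal, while
    any other permutation picks an off-diagonal entry, which is a nonunit. *)
Lemma unitmx_1D n (E : 'M[A]_n) : mmx (E - 1%:M) -> E \in unitmx.
Proof.
move=> hE; rewrite unitmxE.
suff: maxid (1 - \det E).
  by move=> h; apply/negPn/negP => /maxid1B; apply.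
rewrite -opprB -mulN1r; apply: maxidM.
rewrite /determinant (bigD1 1%g) //= odd_perm1 expr0 mul1r addrAC.
apply: hloc.
  apply: maxid_prod1 => i; have := hE i i.
  by rewrite !mxE eqxx perm1.
apply: maxid_sum => s s1; apply: maxidM.
have [i si] : exists i, s i != i.
  apply: contrapT => /forallNP h; case/eqP: s1; apply/permP => i.
  by rewrite perm1; apply/eqP/negPn/negP/h.
rewrite (bigD1 i) //= mulrC; apply: maxidM.
by have := hE i (s i); rewrite !mxE eq_sym (negbTE si) subr0.
Qed.

Lemma mmx_retract_leq n p (f : 'M[A]_(n, p)) (g : 'M[A]_(p, n)) :
  mmx (f *m g - 1%:M) -> (n <= p)%N.
Proof.
move=> h; rewrite leqNgt; apply/negP => pn.
have [q en] : exists q, n = (p + q.+1)%N.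
  by exists (n - p).-1; rewrite prednK ?subn_gt0 // subnKC // ltnW.
subst n; have := unitmx_1D h.
(* Padding with zeros makes both factors square, and the second one has a zero row. *)
have -> : f *m g = row_mx f (0 : 'M[A]_(p + q.+1, q.+1)) *m col_mx g 0.
  by rewrite mul_row_col mul0mx addr0.
rewrite unitmx_mul !unitmxE => /andP [_].
rewrite (expand_det_row _ (rshift p ord0)) big1 ?unitr0 // => j _.
by rewrite col_mxEd mxE mul0r.
Qed.

Lemma lift_rows p q n (X : 'M[A]_(p, n)) (D : 'M[A]_(q, n)) :
  (forall i, exists y : 'rV[A]_q, row i X = y *m D) -> exists Y, X = Y *m D.
Proof.
move=> /choice [y hy]; exists (\matrix_i y i).
by apply/row_matrixP => i; rewrite row_mul rowK.
Qed.

(** Matrices act on row vectors from the right. Nothing is asked in degree 0, so the complex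
    resolves the cokernel of [D 0]. *)
Definition acyclic (n : nat -> nat) (D : forall j, 'M[A]_(n j.+1, n j)) : Prop :=
  forall j (x : 'rV[A]_(n j.+1)),
    x *m D j = 0 <-> exists y : 'rV[A]_(n j.+2), x = y *m D j.+1.

Lemma acyclic_lift n D j p (X : 'M[A]_(p, n j.+1)) :
  @acyclic n D -> X *m D j = 0 -> exists Y, X = Y *m D j.+1.
Proof.
move=> hD XD; apply: lift_rows => i; apply/hD.
by rewrite -row_mul XD linear0.
Qed.

Lemma acyclic_comp n D j : @acyclic n D -> D j.+1 *m D j = 0.
Proof.
move=> hD; apply/row_matrixP => i; rewrite linear0 row_mul; apply/hD.
by exists (delta_mx 0 i); rewrite rowE.
Qed.

(* The composite of the lifts of [f0] and [g0] is homotopic to the identity, hence invertible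
   because the homotopy has coefficients in the maximal ideal. *)
Lemma minimal_retract_leq n D q C
    (f0 : 'M[A]_(n 0%N, q 0%N)) (g0 : 'M[A]_(q 0%N, n 0%N)) :
  @acyclic n D -> @acyclic q C -> (forall j, mmx (D j)) -> f0 *m g0 = 1%:M ->
  (exists f1, D 0%N *m f0 = f1 *m C 0%N) ->
  (exists g1, C 0%N *m g0 = g1 *m D 0%N) ->
  forall j, (n j <= q j)%N.
Proof.
move=> hD hC mD fg1 hf0 hg0.
(* [X] is the part of the homotopy that comes from the previous degree, namely [D] followed by the
   previous [h]; it vanishes in degree 0. *)
have key j : exists (f : 'M[A]_(n j, q j)) (g : 'M[A]_(q j, n j))
    (X : 'M[A]_(n j)) (h : 'M[A]_(n j, n j.+1)),
    [/\ exists f', D j *m f = f' *m C j, exists g', C j *m g = g' *m D j,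
     f *m g - 1%:M = X + h *m D j, D j *m X = 0 & mmx X].
  elim: j => [|j [f [g [X [h [[f' ef] [g' eg] efg DX mX]]]]]].
    exists f0, g0, 0, 0; split=> //; last exact: mmx0.
      by rewrite fg1 subrr mul0mx addr0.
    by rewrite mulmx0.
  (* What the old homotopy does not account for is a cycle; lifting it gives the next homotopy. *)
  have : (f' *m g' - 1%:M - D j *m h) *m D j = 0.
    rewrite !mulmxBl -mulmxA -eg mulmxA -ef mul1mx.
    have -> : D j *m f *m g = D j *m (f *m g - 1%:M) + D j.
      by rewrite mulmxBr mulmx1 subrK mulmxA.
    by rewrite addrK efg mulmxDr DX add0r mulmxA subrr.
  move=> /(acyclic_lift hD) [h' eh].
  exists f', g', (D j *m h), h'; split.
  - apply: (acyclic_lift hC).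
    by rewrite -mulmxA -ef mulmxA acyclic_comp // mul0mx.
  - apply: (acyclic_lift hD).
    by rewrite -mulmxA -eg mulmxA acyclic_comp // mul0mx.
  - by rewrite -eh [RHS]addrC subrK.
  - by rewrite mulmxA acyclic_comp // mul0mx.
  - exact: mmx_mulr.
move=> j; have [f [g [X [h [_ _ efg _ mX]]]]] := key j.
apply: (@mmx_retract_leq _ _ f g); rewrite efg; apply: mmxD => //.
exact: mmx_mull.
Qed.

(* A minimal free resolution of the vector space [k^(n 0)]. *)
Definition mcomplex n (D : forall j, 'M[A]_(n j.+1, n j)) : Prop :=
  [/\ acyclic D, forall j, mmx (D j) &
   forall z : 'rV[A]_(n 0%N), cw (@maxid A) z -> exists y, z = y *m D 0%N].

Lemma mcomplex_lift n D p (X : 'M[A]_(p, n 0%N)) :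
  @mcomplex n D -> mmx X -> exists Y, X = Y *m D 0%N.
Proof. by case=> _ _ h mX; apply: lift_rows => i; apply/h/mmx_row. Qed.

(** The types vary with the index, so the recursion runs through the subtypes cut out by [P]. *)
Lemma dependent_choice (T : nat -> Type) (P : forall j, T j -> Prop)
    (Q : forall j, T j -> T j.+1 -> Prop) (t0 : T 0%N) :
  P 0%N t0 -> (forall j t, P j t -> exists t', P j.+1 t' /\ Q j t t') ->
  exists f : forall j, T j, f 0%N = t0 /\ forall j, Q j (f j) (f j.+1).
Proof.
move=> P0 step.
pose next j (s : {t : T j | P j t}) : {t : T j.+1 | P j.+1 t} :=
  let c := cid (step j (sval s) (svalP s)) in
  exist _ (sval c) (proj1 (svalP c)).
pose F := nat_rect (fun j => {t : T j | P j t}) (exist _ t0 P0) next.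
exists (fun j => sval (F j)); split=> // j.
exact: (proj2 (svalP (cid (step j (sval (F j)) (svalP (F j)))))).
Qed.

(** * Mapping cones *)

Section Cone.
Variables (n : nat -> nat) (D : forall j, 'M[A]_(n j.+1, n j)).
Variables (p : nat -> nat) (E : forall j, 'M[A]_(p j.+1, p j)).
Variable w : 'M[A]_(p 0%N, n 0%N).
Hypotheses (hD : acyclic D) (hE : mcomplex E).
Hypothesis w_lift : exists t, E 0%N *m w = t *m D 0%N.
Hypothesis w_indep :
  forall z t, z *m w = t *m D 0%N -> cw (@maxid A) z.

(** Degreewise lifting along [D]. The squares anticommute, so that the block matrices of the cone
    compose to zero without further signs. *)
Lemma cone_maps : exists psi : forall j, 'M[A]_(p j, n j),
  psi 0%N = w /\ forall j, E j *m psi j + psi j.+1 *m D j = 0.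
Proof.
apply: (@dependent_choice (fun j => 'M[A]_(p j, n j))
  (fun j f => exists t, E j *m f = t *m D j)
  (fun j f f' => E j *m f + f' *m D j = 0)) => // j f [t et].
have [aE _ _] := hE.
exists (- t); rewrite mulNmx et subrr; split=> //.
apply: (acyclic_lift hD).
by rewrite -mulmxA mulNmx -et mulmxN mulmxA acyclic_comp // mul0mx oppr0.
Qed.

Definition cone_rank j : nat := if j is i.+1 then (n i.+1 + p i)%N else n 0%N.

Definition cone_diff (psi : forall j, 'M[A]_(p j, n j)) j :
    'M[A]_(cone_rank j.+1, cone_rank j) :=
  match j return 'M[A]_(cone_rank j.+1, cone_rank j) with
  | 0%N => col_mx (D 0%N) (psi 0%N)
  | i.+1 => block_mx (D i.+1) 0 (psi i.+1) (E i)
  end.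

(** In the lowest degree, [w_indep] says that [w] is injective from k^(p 0) to the cokernel of
    [D 0], so the second component of a cycle has nonunit entries and lifts along [E 0]. Above it,
    exactness of [E] gives this lift. *)
Lemma cone_acyclic psi : psi 0%N = w ->
  (forall j, E j *m psi j + psi j.+1 *m D j = 0) -> acyclic (cone_diff psi).
Proof.
move=> psi0 hpsi; have [aE mE lE] := hE.
have psiE j : E j *m psi j = - (psi j.+1 *m D j).
  by apply/eqP; rewrite -subr_eq0 opprK hpsi.
(* Once [y] is lifted to [y'], correcting [x] by [y' *m psi j.+1] yields a cycle of [D]. *)
have fin j (x : 'rV[A]_(n j.+1)) (y : 'rV[A]_(p j)) y' :
    x *m D j + y *m psi j = 0 -> y = y' *m E j ->
    exists z : 'rV[A]_(n j.+2 + p j.+1),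
      row_mx x y = z *m block_mx (D j.+1) 0 (psi j.+1) (E j).
  move=> exy ey; have : (x - y' *m psi j.+1) *m D j = 0.
    by rewrite mulmxBl -mulmxA -[psi _ *m D j]opprK -psiE mulmxN opprK mulmxA -ey.
  move=> /hD [x' ex]; exists (row_mx x' y').
  by rewrite mul_row_block mulmx0 add0r -ey -ex subrK.
case=> [|j] x; rewrite -[x](@hsubmxK _ _ (n _) (p _)) /=;
  move: (lsubmx _) (rsubmx _) => {}x y; split.
- rewrite mul_row_col psi0 => exy.
  have my : cw (@maxid A) y.
    apply: (@w_indep y (- x)); rewrite mulNmx.
    by apply/eqP; rewrite -subr_eq0 opprK addrC exy.
  have [y' ey] := lE _ my; apply: fin ey; by rewrite psi0.
- case=> z; rewrite -[z]hsubmxK mul_row_block mulmx0 add0r => /eq_row_mx [-> ->].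
  rewrite mul_row_col mulmxDl -!mulmxA acyclic_comp // mulmx0 add0r -mulmxDr.
  by rewrite addrC hpsi mulmx0.
- rewrite mul_row_block mulmx0 add0r => /eqP.
  rewrite row_mx_eq0 => /andP [/eqP exy /eqP ey].
  by have [y' ey'] := (aE _ _).1 ey; apply: fin ey'.
- case=> z; rewrite -[z]hsubmxK mul_row_block mulmx0 add0r => /eq_row_mx [-> ->].
  rewrite mul_row_block mulmx0 add0r mulmxDl -!mulmxA !acyclic_comp // !mulmx0.
  by rewrite add0r -mulmxDr addrC hpsi mulmx0 row_mx0.
Qed.

End Cone.

(* [w] lifts a basis of [mS], where [S] is the cokernel of [D 0]; the cone
   resolves [S / mS], whose minimal resolution is [G]. *)
Lemma cone_leq n D p E b G (w : 'M[A]_(p 0%N, n 0%N)) :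
  @acyclic n D -> (forall j, mmx (D j)) -> @mcomplex p E -> @mcomplex b G ->
  b 0%N = n 0%N -> mmx w ->
  (forall z, cw (@maxid A) z -> exists t, z *m w = t *m D 0%N) ->
  (forall z t, z *m w = t *m D 0%N -> cw (@maxid A) z) ->
  (forall y, cw (@maxid A) y -> exists t z, y = t *m D 0%N + z *m w) ->
  forall j, (b j.+1 <= n j.+1 + p j)%N.
Proof.
move=> hD mD hE hG eb mw wl wi wg.
have [_ mE _] := hE; have [aG mG lG] := hG.
have w_lift : exists t, E 0%N *m w = t *m D 0%N.
  by apply: lift_rows => i; rewrite row_mul; apply/wl/mmx_row.
have [psi [psi0 hpsi]] := cone_maps hD hE w_lift.
have hC := cone_acyclic hD hE wi psi0 hpsi.
(* The first differential of the cone lands in m F, which lets the comparison map from the cone to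
   [G] start. *)
have mC : mmx (cone_diff D E psi 0).
  move=> i j; rewrite /= mxE psi0; case: splitP => k _; [exact: mD|exact: mw].
have [f [g fg]] : exists (f : 'M[A]_(b 0%N, n 0%N)) (g : 'M[A]_(n 0%N, b 0%N)),
    f *m g = 1%:M.
  by rewrite eb; exists 1%:M, 1%:M; rewrite mul1mx.
move=> j.
apply: (@minimal_retract_leq b G (cone_rank n p) (cone_diff D E psi) f g
  aG hC mG fg _ _ j.+1).
- apply: lift_rows => i; have /wg [t [z e]] : cw (@maxid A) (row i (G 0%N *m f)).
    by apply/mmx_row/mmx_mulr.
  by exists (row_mx t z); rewrite e /= mul_row_col psi0.
- by apply: mcomplex_lift => //; apply: mmx_mulr.
Qed.

End Complexes.

(** * Minimal resolutions *)

Section Resolutions.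
Variables (A : comUnitRingType) (hloc : is_local A).

(** A unit coefficient in a relation makes the corresponding generator redundant, against
    minimality. *)
Lemma mingens_indep (V : lmodType A) (S N : V -> Prop) m (g : 'I_m -> V) x :
  is_submod N -> mingens S N m -> generates S N g -> N (comb x g) ->
  forall j, maxid (x 0 j).
Proof.
move=> hN [_ min] [Sg gen] Nx j; apply/negP => ux.
case: m g x j min Sg gen Nx ux => [g x []//|m] g x j min Sg gen Nx ux.
suff: (m.+1 <= m)%N by rewrite ltnn.
apply: (min _ (fun i => g (lift j i))); split=> [i|v /gen [y Ny]]; first exact: Sg.
(* Subtracting [c] times the relation cancels the coefficient of [g j]. *)
pose c := y 0 j / x 0 j.
exists (\row_i (y 0 (lift j i) - c * x 0 (lift j i))).
have -> : v - comb (\row_i (y 0 (lift j i) - c * x 0 (lift j i)))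
      (fun i => g (lift j i)) = (v - comb y g) + c *: comb x g.
  rewrite -combZ -addrA; congr (_ + _); apply: oppr_inj.
  rewrite opprK opprD opprK -combB [RHS]/comb (bigD1_ord j) //= !mxE divrK // subrr scale0r add0r.
  by apply: eq_bigr => i _; rewrite !mxE.
by apply: submodD => //; apply: submodZ.
Qed.

Lemma comb_row m n (x : 'rV[A]_m) (D : 'M[A]_(m, n)) :
  comb x (fun i => row i D) = x *m D.
Proof. by rewrite mulmx_sum_row. Qed.

Lemma syz_step_submod (V : lmodType A) (S N : V -> Prop) m (K : 'rV[A]_m -> Prop) :
  is_submod N -> syz_step S N K -> is_submod K.
Proof.
move=> hN [_ [g [_ KE]]]; split=> [|a x y /KE Nx /KE Ny]; apply/KE.
  by rewrite comb0; apply: submod0.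
by rewrite combD combZ; apply: submodD => //; apply: submodZ.
Qed.

Lemma syz_step_maxid (V : lmodType A) (S N : V -> Prop) m (K : 'rV[A]_m -> Prop) :
  is_submod N -> syz_step S N K -> forall x, K x -> cw (@maxid A) x.
Proof. by move=> hN [hm [g [hg KE]]] x /KE; apply: mingens_indep hg. Qed.

(** The rows of [D i] are the generators of [Om i] chosen by the resolution, which turns syzygies
    into row spaces and kernels. *)
Lemma min_resolution_complex (V : lmodType A) (S N : V -> Prop) n Om :
  is_submod N -> @min_resolution A V S N n Om ->
  [/\ forall i, is_submod (Om i), forall i x, Om i x -> cw (@maxid A) x &
   exists D : forall i, 'M[A]_(n i.+1, n i),
     forall i, (forall x, Om i x <-> exists y, x = y *m D i) /\
               (forall x, Om i.+1 x <-> x *m D i = 0)].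
Proof.
move=> hN [step0 step].
have hOm i : is_submod (Om i).
  case: i => [|i]; first exact: syz_step_submod step0.
  by apply: syz_step_submod (step i); apply: is_submod0.
have mOm i x : Om i x -> cw (@maxid A) x.
  case: i x => [|i]; first exact: syz_step_maxid step0.
  by apply: syz_step_maxid (step i); apply: is_submod0.
split=> //.
suff h i : exists D : 'M[A]_(n i.+1, n i),
    (forall x, Om i x <-> exists y, x = y *m D) /\
    (forall x, Om i.+1 x <-> x *m D = 0).
  by exists (fun i => sval (cid (h i))) => i; apply: (svalP (cid (h i))).
have [_ [g [[Og gen] KE]]] := step i; exists (\matrix_j g j).
have cE x : comb x g = x *m \matrix_j g j.
  by rewrite -comb_row; apply: eq_bigr => j _; rewrite rowK.
split=> x; last by rewrite KE cE.
split=> [/gen [y /eqP]|[y ->]].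
  by rewrite subr_eq0 cE => /eqP ->; exists y.
by rewrite -cE; apply: submod_comb.
Qed.

Lemma rowspace_acyclic n (D : forall i, 'M[A]_(n i.+1, n i))
    (Om : forall i, 'rV[A]_(n i) -> Prop) :
  (forall i, (forall x, Om i x <-> exists y, x = y *m D i) /\
             (forall x, Om i.+1 x <-> x *m D i = 0)) -> acyclic D.
Proof.
by move=> h j x; rewrite -(h j).2 (h j.+1).1.
Qed.

Lemma rowspace_mmx m n (D : 'M[A]_(m, n)) (K : 'rV[A]_n -> Prop) :
  (forall x, K x -> cw (@maxid A) x) ->
  (forall x, K x <-> exists y, x = y *m D) -> mmx D.
Proof.
move=> mK KE i j; have : K (row i D) by apply/KE; exists (delta_mx 0 i); rewrite rowE.
by move=> /mK /(_ j); rewrite mxE.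
Qed.

(* Betti numbers of [k^c], with the normalization [nk 0 = 1] built in. *)
Definition kr (nk : nat -> nat) (c j : nat) : nat :=
  if j is i.+1 then (c * nk i.+1)%N else c.

Lemma const1_inj c n (Z : 'M[A]_(c, n)) : n = 1%N ->
  Z *m (const_mx 1 : 'cV[A]_n) = 0 -> Z = 0.
Proof.
move=> en; subst n => /matrixP h; apply/matrixP => i j.
by have := h i 0; rewrite !mxE big_ord1 mxE mulr1 (ord1 j).
Qed.

Lemma mmx_mxvec m n (X : 'M[A]_(m, n)) : mmx X -> mmx (mxvec X).
Proof. by move=> mX i k; rewrite ord1; case/mxvec_indexP: k => a b; rewrite mxvecE. Qed.

Lemma k_mingens_card m : mingens (fun _ : A^o => True) (@maxid A) m -> m = 1%N.
Proof.
move=> [[g [_ gen]] min]; apply/eqP; rewrite eqn_leq; apply/andP; split.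
  apply: (min 1%N (fun=> 1)); split=> // v _; exists (const_mx v).
  rewrite /comb big_ord1 mxE; have -> : v *: (1 : A^o) = v by apply: mulr1.
  by rewrite subrr; apply: maxid0.
rewrite lt0n; apply/eqP => m0; subst m; have [x] := gen 1 I.
by rewrite /comb big_ord0 subr0 /maxid unitr1.
Qed.

(** A direct sum of [c] copies of the resolution of k: vectors of length [c * nk j] are flattened
    matrices with [c] rows, on which the differential acts by right multiplication. *)
Lemma k_copies nk Omk :
  @min_resolution A A^o (fun _ => True) (@maxid A) nk Omk ->
  forall c, exists E : forall j, 'M[A]_(kr nk c j.+1, kr nk c j), mcomplex E.
Proof.
move=> hres c; have hm := maxid_submod hloc.
have [hOm mOm [D hD]] := min_resolution_complex hm hres.
have aD := rowspace_acyclic hD.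
have mD i := rowspace_mmx (mOm i) (hD i).1.
have nk0 : nk 0%N = 1%N by case: hres => -[/k_mingens_card].
(* As [nk 0] equals 1 only propositionally, the column of ones serves to identify row vectors of
   length [nk 0] with scalars. *)
pose h : 'cV[A]_(nk 1%N) := D 0%N *m const_mx 1.
pose f := trmx \o mulmxr h \o vec_mx : 'rV[A]_(c * nk 1%N) -> 'rV[A]_c.
pose E0 : 'M[A]_(c * nk 1%N, c) := lin1_mx f.
have E0E x : x *m E0 = (vec_mx x *m h)^T by rewrite /E0 /f mul_rV_lin1.
pose E j : 'M[A]_(kr nk c j.+1, kr nk c j) :=
  match j return 'M[A]_(kr nk c j.+1, kr nk c j) with
  | 0%N => E0 | i.+1 => lin_mulmxr (D i.+1) end.
have hX j (X : 'M[A]_(c, nk j.+1)) : X *m D j = 0 <-> exists Y, X = Y *m D j.+1.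
  split; first exact: acyclic_lift.
  by case=> Y ->; rewrite -mulmxA acyclic_comp // mulmx0.
have hv j (x : 'rV[A]_(c * nk j.+1)) :
    vec_mx x *m D j = 0 <-> exists y, x = y *m lin_mulmxr (D j.+1).
  rewrite hX; split=> [[Y eY]|[y ->]].
    by exists (mxvec Y); rewrite mul_vec_lin /= -eY vec_mxK.
  by exists (vec_mx y); rewrite mul_rV_lin /= mxvecK.
have mh : mmx h by apply: mmx_mulr.
exists E; split.
- case=> [|j] x /=; rewrite -hv.
    rewrite E0E; split=> [e|e]; last by rewrite /h mulmxA e mul0mx trmx0.
    apply: const1_inj => //; rewrite -mulmxA -/h.
    by rewrite -[LHS]trmxK e trmx0.
  rewrite mul_rV_lin /=; split=> [e|->]; last by rewrite linear0.
  by rewrite -[LHS]mxvecK e linear0.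
- case=> [|j] i k /=; rewrite mxE.
    by rewrite /f /= mxE; apply: mmx_mull.
  by rewrite /=; apply: mmx_mxvec; apply: mmx_mull.
- move=> z mz.
  (* A nonunit scalar lies in the first syzygy of k, hence in the row space of [D 0]. *)
  have hy i : exists y : 'rV[A]_(nk 1%N), (y *m h) 0 0 = z 0 i.
    have : Omk 0%N (const_mx (z 0 i)).
      have [[_ [g [_ KE]]] _] := hres; apply/KE; apply: maxid_sum => // j _.
      by rewrite mxE [_ *: _]mulrC; apply: maxidM.
    move=> /(hD 0%N).1 [y ey]; exists y; rewrite /h mulmxA -ey.
    rewrite mxE (eq_bigr (fun=> z 0 i)) => [|j _]; last by rewrite !mxE mulr1.
    by rewrite sumr_const card_ord nk0.
  have [y ey] := choice hy; exists (mxvec (\matrix_i y i)).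
  rewrite /= E0E mxvecK; apply/rowP => i; rewrite mxE -ey.
  by rewrite !mxE; apply: eq_bigr => k _; rewrite [in RHS]mxE.
Qed.

(** The class of [c] in the cokernel of [D 0] is killed by m, and its coordinate [t], well defined
    modulo m, is a unit. So k is a direct summand of the cokernel, with splitting given by that
    coordinate divided by [c 0 t]. *)
Lemma k_summand_leq nk Omk n D (c : 'rV[A]_(n 0%N)) t :
  @min_resolution A A^o (fun _ => True) (@maxid A) nk Omk ->
  @acyclic A n D -> (forall j, mmx (D j)) -> ~ maxid (c 0 t) ->
  (forall x, maxid x -> exists y, x *: c = y *m D 0%N) ->
  forall j, (nk j.+1 <= n j.+1)%N.
Proof.
move=> hres hD mD /negP/negPn uc hc j.
have [E hE] := k_copies hres 1; have [aE mE _] := hE.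
suff: (kr nk 1 j.+1 <= n j.+1)%N by rewrite /kr mul1n.
apply: (@minimal_retract_leq A hloc (kr nk 1) E n D c
  ((c 0 t)^-1 *: delta_mx t 0) aE hD mE _ _ _ j.+1).
- rewrite -scalemxAr -colE; apply/matrixP => i k.
  by rewrite !ord1 !mxE eqxx mulVr.
- apply: lift_rows => i.
  have [y ey] := hc _ (mE 0%N i 0); exists y; rewrite -ey.
  by apply/rowP => k; rewrite !mxE big_ord1.
- by apply: mcomplex_lift => //; apply: mmx_mulr.
Qed.

End Resolutions.

(** * Growth of recurrent sequences *)

Section Growth.
Variable K : realType.
Implicit Types (x y c : K) (b g u : nat -> nat).

Lemma geometric_small (q c e : K) : 0 <= q < 1 -> 0 < e ->
  exists N, forall n, (N <= n)%N -> c * q ^+ n < e.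
Proof.
move=> /andP [q0 q1] e0.
have h : `|q| < 1 by rewrite ger0_norm.
have [N _ hN] := cvgr_lt 0 (cvg_geometric c h) _ e0.
by exists N => n /hN.
Qed.

Lemma geometric_le0 (q c e : K) : 0 <= q < 1 ->
  (forall n, e <= c * q ^+ n) -> e <= 0.
Proof.
move=> hq h; rewrite leNgt; apply/negP => /(geometric_small c hq) [N /(_ N (leqnn _))].
by rewrite ltNge h.
Qed.

Lemma eventually_le_geometric b x N : 0 < x ->
  (forall n, (N <= n)%N -> (b n)%:R <= x ^+ n) ->
  exists c, forall n, (b n)%:R <= c * x ^+ n.
Proof.
move=> x0 hb; exists (1 + \sum_(i < N) (b i)%:R / x ^+ i) => n.
have s0 (P : pred 'I_N) : 0 <= \sum_(i < N | P i) (b i)%:R / x ^+ i.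
  by apply: sumr_ge0 => i _; rewrite divr_ge0 // exprn_ge0 // ltW.
have xn0 : 0 < x ^+ n by rewrite exprn_gt0.
have [Nn|nN] := leqP N n.
  apply: le_trans (hb _ Nn) _; rewrite ler_peMl ?(ltW xn0) //.
  by rewrite lerDl s0.
rewrite -ler_pdivrMr // (bigD1 (Ordinal nN)) //= addrCA lerDl addr_ge0 //.
Qed.

Definition root_seq b n : \bar K := ((b n)%:R `^ n%:R^-1)%:E.

Lemma root_seq_expn b n : (0 < n)%N -> ((b n)%:R `^ n%:R^-1) ^+ n = (b n)%:R :> K.
Proof.
move=> n0; rewrite -powR_mulrn ?powR_ge0 // -powRrM mulVf ?powRr1 //.
by rewrite pnatr_eq0 -lt0n.
Qed.

Lemma limn_esup_inf (v : nat -> \bar K) :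
  limn_esup v = ereal_inf (range (esups v)).
Proof. by rewrite limn_esup_lim; apply: cvg_lim => //; apply: cvg_esups_inf. Qed.

Lemma limn_root_lt b x : 0 < x -> (limn_esup (root_seq b) < x%:E)%E ->
  exists c, forall n, (b n)%:R <= c * x ^+ n.
Proof.
move=> x0; rewrite limn_esup_inf => /ereal_inf_lt [_ [N _ <-] hN].
apply: (@eventually_le_geometric _ _ N.+1) => // n Nn.
have : (root_seq b n < x%:E)%E.
  apply: le_lt_trans hN; apply: ereal_sup_ubound; exists n => //=.
  exact: ltnW.
rewrite lte_fin => /ltW h; rewrite -root_seq_expn; last exact: leq_ltn_trans Nn.
by rewrite lerXn2r ?nnegrE ?powR_ge0 // ltW.
Qed.

(** Passing from [x] to [y] absorbs the constant, since c (x/y)^n is eventually below 1. *)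
Lemma limn_root_le b x y c : 0 < x -> x < y ->
  (forall n, (b n.+1)%:R <= c * x ^+ n.+1) ->
  (limn_esup (root_seq b) <= y%:E)%E.
Proof.
move=> x0 xy hb; have y0 := lt_trans x0 xy.
have [|N hN] := @geometric_small (x / y) c 1 _ ltr01.
  by rewrite divr_ge0 ?(ltW x0) ?(ltW y0) // ltr_pdivrMr // mul1r.
rewrite limn_esup_inf; apply: (@le_trans _ _ (esups (root_seq b) N.+1)).
  by apply: ereal_inf_lbound; exists N.+1.
apply: ge_ereal_sup => _ [n /= Nn <-]; rewrite lee_fin.
have n0 : (0 < n)%N by apply: leq_ltn_trans Nn.
rewrite -(@ler_pXn2r _ n) ?nnegrE ?powR_ge0 ?(ltW y0) // root_seq_expn //.
have := hN n (ltnW Nn); rewrite expr_div_n mulrA ltr_pdivrMr ?exprn_gt0 // mul1r.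
by move/ltW; apply: le_trans; case: n n0 {Nn} => // n _; apply: hb.
Qed.

Lemma limn_root_ge0 b : (0 <= limn_esup (root_seq b))%E.
Proof.
rewrite limn_esup_inf; apply: le_ereal_inf_tmp => _ [n _ <-].
apply: (@le_trans _ _ (root_seq b n)); first by rewrite lee_fin powR_ge0.
by apply: ereal_sup_ubound; exists n => /=.
Qed.

(** Replaces the inequality between curvatures by two growth statements separated by the gap between
    [x0] and [x]. *)
Lemma limn_root_sep b g :
  (limn_esup (root_seq b) < limn_esup (root_seq g))%E ->
  exists x0 x c, [/\ 0 < x0, x0 < x, forall n, (b n)%:R <= c * x0 ^+ n &
    forall d, ~ forall n, (g n.+1)%:R <= d * x ^+ n.+1].
Proof.
move=> bg; have := limn_root_ge0 b.
(* The third number [y] leaves room for the constant lost in [limn_root_le]; the upper limit of [g]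
   may be infinite. *)
have [x0 [x [y [bx x0x xy yg]]]] : exists x0 x y : K,
    [/\ (limn_esup (root_seq b) < x0%:E)%E, x0 < x, x < y &
        (y%:E < limn_esup (root_seq g))%E].
  move: bg; case: (limn_esup (root_seq b)) (limn_root_ge0 b) => [a| |] //= _;
    case: (limn_esup (root_seq g)) => [c| |] //=.
    rewrite lte_fin => ac.
    exists ((3 * a + c) / 4), ((2 * a + 2 * c) / 4), ((a + 3 * c) / 4).
    by rewrite !lte_fin; split; lra.
  move=> _; exists (a + 1), (a + 2), (a + 3); rewrite !lte_fin ltry.
  by split=> //; lra.
move=> b0; have x00 : 0 < x0 by rewrite -lte_fin; apply: le_lt_trans bx.
have [c hc] := limn_root_lt x00 bx.
exists x0, x, c; split=> // d /(limn_root_le (lt_trans x00 x0x) xy).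
by rewrite leNgt yg.
Qed.

(** The growth of [g] bounds the ratios of [u] by r/x. With u n = O(x0^n) this makes [u] geometric,
    and its ratio is a rational root of a monic integral polynomial, hence an integer. *)
Lemma ratio_rigid (e r : nat) u g (x0 x c : K) : (0 < r)%N -> 0 < x0 -> x0 < x ->
  (forall i, u i.+2 + r * u i = e * u i.+1)%N ->
  (forall i j, u i.+1 * g j.+1 <= u (j + i).+2 + r * u i * g j)%N ->
  (forall n, (u n)%:R <= c * x0 ^+ n) ->
  (forall d, ~ forall n, (g n.+1)%:R <= d * x ^+ n.+1) ->
  u 0%N <> 0%N ->
  exists a, [/\ (a * (e - a) = r)%N, (a < e - a)%N &
    forall i, u i.+1 = (a * u i)%N].
Proof.
move=> r0 x00 x0x rec hg hu ng u0; have xp := lt_trans x00 x0x.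
(* A zero right after a positive term would contradict the recurrence, as [r] is positive. *)
have upos i : (0 < u i)%N.
  elim: i => [|i IH]; first by rewrite lt0n; apply/eqP.
  rewrite lt0n; apply/eqP => ui; have := rec i; rewrite ui muln0 => /eqP.
  by rewrite addn_eq0 muln_eq0 (gtn_eqF r0) (gtn_eqF IH) andbF.
have uposR i : (0 : K) < (u i)%:R by rewrite ltr0n.
have recR i : (u i.+2)%:R = e%:R * (u i.+1)%:R - r%:R * (u i)%:R :> K.
  by rewrite -!natrM -rec natrD addrK.
have c0 : 0 <= c by have := hu 0%N; rewrite expr0 mulr1; apply: le_trans.
have le_ur i : x * (u i.+1)%:R <= r%:R * (u i)%:R.
  rewrite leNgt; apply/negP => lt.
  (* Divided by [u i.+1], the inequality [hg] becomes g (n+1) <= c' x^n + s g n with s < x. The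
     constant [d] satisfies c' + s d <= x d, so induction gives g n <= d x^n, contradicting [ng]. *)
  pose s := r%:R * (u i)%:R / (u i.+1)%:R : K.
  have s0 : 0 <= s by rewrite divr_ge0 // mulr_ge0.
  have sx : 0 < x - s by rewrite subr_gt0 ltr_pdivrMr.
  pose c' := c * x0 ^+ i.+2 / (u i.+1)%:R.
  have c'0 : 0 <= c' by rewrite divr_ge0 // mulr_ge0 // exprn_ge0 // ltW.
  pose d := (g 0%N)%:R + c' / (x - s).
  apply: (ng d) => n; move: n.+1 => {}n.
  elim: n => [|n IH].
    by rewrite expr0 mulr1 lerDl divr_ge0 // ltW.
  have h1 : (g n.+1)%:R <= c' * x ^+ n + s * (g n)%:R.
    rewrite -(ler_pM2l (uposR i.+1)) mulrDr.
    have -> : (u i.+1)%:R * (c' * x ^+ n) = c * x0 ^+ i.+2 * x ^+ n.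
      by rewrite /c'; field; rewrite gt_eqF.
    have -> : (u i.+1)%:R * (s * (g n)%:R) = (r * u i * g n)%:R.
      by rewrite /s !natrM; field; rewrite gt_eqF.
    rewrite -natrM; apply: (@le_trans _ _ (u (n + i).+2 + r * u i * g n)%:R).
      by rewrite ler_nat.
    rewrite natrD lerD2r; apply: le_trans (hu _) _.
    have -> : (n + i).+2 = (i.+2 + n)%N by rewrite addnC.
    rewrite exprD mulrA; apply: ler_wpM2l.
      by apply: mulr_ge0 => //; apply: exprn_ge0; apply: ltW.
    by rewrite lerXn2r ?nnegrE ?(ltW x00) ?(ltW xp) // ltW.
  apply: le_trans h1 _.
  have h2 : s * (g n)%:R <= s * (d * x ^+ n) by rewrite ler_wpM2l.
  have h3 : c' * x ^+ n <= (x - s) * d * x ^+ n.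
    rewrite ler_wpM2r ?exprn_ge0 ?(ltW xp) // /d mulrDr mulrCA divff ?gt_eqF //.
    by rewrite mulr1 lerDr mulr_ge0 // ltW.
  rewrite exprS; apply: le_trans (lerD h3 h2) _.
  by rewrite le_eqVlt; apply/orP; left; apply/eqP; ring.
have ule n : (u n)%:R <= (u 0%N)%:R * (r%:R / x) ^+ n.
  elim: n => [|n IH]; first by rewrite expr0 mulr1.
  apply: (@le_trans _ _ (r%:R / x * (u n)%:R)).
    by rewrite mulrAC ler_pdivlMr // mulrC.
  by rewrite exprS mulrCA ler_wpM2l // divr_ge0 // ltW.
(* The Casoratian of [u], which the recurrence multiplies by [r] at each step. *)
pose w i := (u i.+1)%:R ^+ 2 - (u i)%:R * (u i.+2)%:R : K.
have wE i : w i = r%:R ^+ i * w 0%N.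
  elim: i => [|i IH]; first by rewrite expr0 mul1r.
  rewrite exprS -mulrA -IH /w (recR i.+1) (recR i); ring.
(* Were [w 0] nonzero, [w n = r^n w 0] would outgrow the product of the bounds
   [u n = O(x0^n)] and [u n = O((r/x)^n)], since [x0 < x]. *)
have w0 : w 0%N = 0.
  apply/normr0_eq0/eqP; rewrite eq_le normr_ge0 andbT.
  pose d := c * (u 0%N)%:R * (x0 * (r%:R / x) + (r%:R / x) ^+ 2).
  apply: (@geometric_le0 (x0 / x) d).
    by rewrite divr_ge0 ?(ltW x00) ?(ltW xp) // ltr_pdivrMr // mul1r.
  move=> n; rewrite -(@ler_pM2l _ (r%:R ^+ n)) ?exprn_gt0 ?ltr0n //.
  have -> : r%:R ^+ n * `|w 0%N| = `|w n|.
    by rewrite [in RHS]wE normrM [X in _ = X * _]ger0_norm ?exprn_ge0.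
  have q0 m : 0 <= (u 0%N)%:R * (r%:R / x) ^+ m.
    by rewrite mulr_ge0 // exprn_ge0 // divr_ge0 // ltW.
  have b1 : (u n.+1)%:R ^+ 2 <=
      (c * x0 ^+ n.+1) * ((u 0%N)%:R * (r%:R / x) ^+ n.+1).
    by rewrite expr2 ler_pM.
  have b2 : (u n)%:R * (u n.+2)%:R <=
      (c * x0 ^+ n) * ((u 0%N)%:R * (r%:R / x) ^+ n.+2).
    by rewrite ler_pM.
  apply: le_trans (ler_normB _ _) _.
  rewrite !ger0_norm ?mulr_ge0 ?exprn_ge0 //.
  apply: le_trans (lerD b1 b2) _; rewrite le_eqVlt; apply/orP; left; apply/eqP.
  by rewrite /d !exprS !exprMn; ring.
have sq i : (u i.+1 * u i.+1 = u i * u i.+2)%N.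
  apply/eqP; rewrite -(eqr_nat K) !natrM -expr2 -subr_eq0 -/(w i) wE w0.
  by rewrite mulr0.
have quad : (u 1%N * u 1%N + r * u 0%N * u 0%N = e * u 1%N * u 0%N)%N.
  by rewrite sq -(rec 0%N) mulnDl mulnC.
(* Rational root argument: in lowest terms q/p the quadratic equation makes p divide q^2, hence
   q. *)
have [a ea] : exists a, (u 1%N = a * u 0%N)%N.
  have d0 : (0 < gcdn (u 0%N) (u 1%N))%N by rewrite gcdn_gt0 upos.
  have /dvdnP [p ep] := dvdn_gcdl (u 0%N) (u 1%N).
  have /dvdnP [q eq] := dvdn_gcdr (u 0%N) (u 1%N).
  move: d0 ep eq; set d := gcdn _ _ => d0 ep eq.
  have cpq : coprime p q.
    rewrite /coprime -(eqn_pmul2r d0) muln_gcdl -ep -eq mul1n.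
    by apply/eqP.
  have qd : (q * q + r * p * p = e * q * p)%N.
    apply/eqP; rewrite -(eqn_pmul2r d0) -(eqn_pmul2r d0); apply/eqP.
    transitivity (u 1%N * u 1%N + r * u 0%N * u 0%N)%N.
      by rewrite eq ep; ring.
    by rewrite quad eq ep; ring.
  have dp : (p %| q * q)%N.
    by rewrite -(@dvdn_addl (r * p * p)) ?dvdn_mull // qd dvdn_mull.
  have /dvdnP [a ea] : (p %| q)%N by rewrite -(Gauss_dvdr q cpq).
  by exists a; rewrite eq ep ea mulnA.
have geo i : (u i.+1 = a * u i)%N.
  elim: i => // i IH; apply/eqP; rewrite -(eqn_pmul2l (upos i)) -sq.
  by rewrite [X in (X * _)%N]IH mulnCA -mulnA.
have qa : (a * a + r = e * a)%N.
  apply/eqP; rewrite -(eqn_pmul2r (upos 0%N)) -(eqn_pmul2r (upos 0%N)).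
  apply/eqP; transitivity (u 1%N * u 1%N + r * u 0%N * u 0%N)%N.
    by rewrite ea; ring.
  by rewrite quad ea; ring.
have ae : (a <= e)%N.
  have [->//|a0] := posnP a.
  by rewrite -(leq_pmul2r a0) -qa leq_addr.
have ra : (a * (e - a) = r)%N by rewrite mulnBr [(a * e)%N]mulnC -qa addKn.
have a0 : (0 < a)%N by rewrite lt0n; apply: contraTneq r0 => a0; rewrite -ra a0.
have a0R : (0 : K) < a%:R by rewrite ltr0n.
exists a; split=> //; rewrite -(ltr_nat K).
have powE n : u n = (u 0%N * a ^ n)%N.
  by elim: n => [|n IH]; rewrite ?muln1 // geo IH expnS mulnCA.
have ax0 : a%:R <= x0.
  rewrite leNgt; apply/negP => x0a.
  have : (u 0%N)%:R <= (0 : K).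
    apply: (@geometric_le0 (x0 / a%:R) c).
      by rewrite divr_ge0 ?(ltW x00) //= ltr_pdivrMr // mul1r.
    move=> n; rewrite expr_div_n mulrA ler_pdivlMr ?exprn_gt0 //.
    by rewrite -natrX -natrM -powE.
  by rewrite leNgt uposR.
(* The chain is a <= x0 < x <= r/a = e - a, so [a] is the smaller root. *)
apply: le_lt_trans ax0 (lt_le_trans x0x _).
have := le_ur 0%N; rewrite geo -ra !natrM mulrA ler_pM2r //.
by rewrite mulrC ler_pM2l.
Qed.

End Growth.

(** * Short local rings *)

Section ShortRing.
Variable A : comUnitRingType.
Hypothesis hloc : is_local A.
Hypothesis m3 : forall x y z : A, maxid x -> maxid y -> maxid z -> x * y * z = 0.

(** The ideal m^2 as the intersection of all ideals containing the products; a membership hypothesis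
    is thus directly an induction principle. *)
Definition maxid2 (a : A) : Prop :=
  forall I : A -> Prop, is_submod (V := A^o) I ->
    (forall x y, maxid x -> maxid y -> I (x * y)) -> I a.

Lemma maxid2_submod : is_submod (V := A^o) maxid2.
Proof.
split=> [I hI _|a x y mx my I hI h]; first exact: (submod0 hI).
by case: (hI) => _ ID; apply: ID; [apply: mx|apply: my].
Qed.

Lemma maxid2_mul (x y : A) : maxid x -> maxid y -> maxid2 (x * y).
Proof. by move=> mx my I _; apply. Qed.

Lemma maxid2_maxid a : maxid2 a -> maxid a.
Proof.
by apply; [exact: maxid_submod|move=> x y _ my; apply: maxidM].
Qed.

Lemma maxid2_maxid_mul a z : maxid2 a -> maxid z -> a * z = 0.
Proof.
move=> ma mz; apply: (ma (fun a => a * z = 0)); last by move=> x y mx my; apply: m3.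
by split=> [|b x y ex ey]; rewrite ?mul0r // mulrDl -mulrA ex ey mulr0 addr0.
Qed.

Lemma cw_maxid2_mulmx m n (y : 'rV[A]_m) (D : 'M[A]_(m, n)) :
  cw (@maxid A) y -> mmx D -> cw maxid2 (y *m D).
Proof.
move=> my mD j; rewrite mxE; apply: (submod_sum (V := A^o)).
  exact: maxid2_submod.
by move=> k _; apply: maxid2_mul => //; apply: mD.
Qed.

Lemma cw_maxid2_mulmx0 m n (x : 'rV[A]_m) (D : 'M[A]_(m, n)) :
  cw maxid2 x -> mmx D -> x *m D = 0.
Proof.
move=> mx mD; apply/rowP => j; rewrite !mxE big1 // => k _.
exact: maxid2_maxid_mul.
Qed.

Lemma clen_eq (V : lmodType A) (N S : V -> Prop) l : clen N S l -> l = 0%N -> N = S.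
Proof. by elim. Qed.

Lemma short_lengths (x0 y0 : A) : maxid x0 -> maxid y0 -> x0 * y0 <> 0 ->
  (exists l, has_length (fun _ : A^o => True) l) ->
  exists e r, [/\ (0 < r)%N, clen (V := A^o) (fun x => x = 0) maxid2 r,
    clen (V := A^o) maxid2 (@maxid A) e &
    clen (V := A^o) (@maxid A) (fun _ => True) 1].
Proof.
move=> mx my xy [L [_ bd]].
have s0 := is_submod0 A^o; have sm := maxid_submod hloc.
have sT := is_submodT A^o.
have [//||L' hL'] := @clen_exists A A^o (fun x => x = 0) (fun _ => True) L m3 s0 sT.
  (* A longer series, cut after [L.+1] steps, would contradict the finite length of A. *)
  move=> S' l /clen_chain [T [T1 T2]] _; rewrite leqNgt; apply/negP => Ll.
  apply: (bd T); split=> j jL.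
    by have [] := T1 j (leq_trans jL Ll).
  exact: (T2 j (leq_trans jL Ll)).
have [r hr] : exists r, clen (V := A^o) (fun x => x = 0) maxid2 r.
  apply: clen_between m3 hL' s0 maxid2_submod _ _ _ => // v ->.
  exact: (submod0 maxid2_submod).
have [e he] : exists e, clen (V := A^o) maxid2 (@maxid A) e.
  apply: clen_between m3 hL' maxid2_submod sm _ _ _ => // v.
    by move=> ->; apply: (submod0 maxid2_submod).
  exact: maxid2_maxid.
exists e, r; split=> //.
  rewrite lt0n; apply/eqP => r0; apply: xy.
  by have := maxid2_mul mx my; rewrite -(clen_eq hr r0).
apply: covers_clen; split=> //; exists 1; split=> //.
- by rewrite /maxid unitr1.
- by move=> w _; exists w; rewrite [_ *: _]mulr1 subrr; apply: maxid0.
- by move=> x xm; rewrite [_ *: _]mulr1.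
Qed.

Variables (e r : nat).
Hypothesis len_m2 : clen (V := A^o) (fun x => x = 0) maxid2 r.
Hypothesis len_m : clen (V := A^o) maxid2 (@maxid A) e.
Hypothesis len_A : clen (V := A^o) (@maxid A) (fun _ => True) 1.

Lemma cw_eq0 n : @cw A n (fun x => x = 0) = (fun x => x = 0).
Proof.
apply/predeqP => x; split=> [h|-> j]; last by rewrite mxE.
by apply/rowP => j; rewrite mxE.
Qed.

Lemma clen_free n :
  clen (fun x : 'rV[A]_n => x = 0) (fun _ => True) ((r + e + 1) * n).
Proof.
have h := clen_cw n (clen_trans (clen_trans len_m2 len_m) len_A).
rewrite cw_eq0 in h; suff <- : @cw A n (fun _ => True) = (fun _ => True) by [].
exact/predeqP.
Qed.

Lemma clen_m2_free n : clen (fun x : 'rV[A]_n => x = 0) (@cw A n maxid2) (r * n).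
Proof. by rewrite -cw_eq0; apply: clen_cw. Qed.

Variables (n : nat -> nat) (Om : forall i, 'rV[A]_(n i) -> Prop).
Variable D : forall i, 'M[A]_(n i.+1, n i).
Hypothesis hOm : forall i, is_submod (@Om i).
Hypothesis mOm : forall i x, @Om i x -> cw (@maxid A) x.
Hypothesis OmD : forall i x, @Om i x <-> exists y, x = y *m D i.
Hypothesis kerD : forall i x, @Om i.+1 x <-> x *m D i = 0.

Let mD i : mmx (D i).
Proof. exact: (rowspace_mmx (@mOm i) (@OmD i)). Qed.

Let aD : acyclic D.
Proof. by apply: (rowspace_acyclic (Om := Om)) => i; split; [exact: OmD|exact: kerD]. Qed.

(** This is m times [Om i], because the rows of [D i] generate [Om i]. *)
Let mOmega i x : Prop := exists2 y, cw (@maxid A) y & x = y *m D i.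

Variables (nk : nat -> nat) (Omk : forall i, 'rV[A]_(nk i) -> Prop).
Hypothesis k_res : min_resolution (fun _ : A^o => True) (@maxid A) Omk.

(** A preimage [c] of [x] has a unit coordinate, and m x = 0 because m^3 = 0, so m c lies in the
    next syzygy. Hence [x] spans a summand k of [Om i.+1], which the complex shifted by [i.+2]
    resolves. *)
Lemma k_summand_betti i x : cw maxid2 x -> ~ @mOmega i.+1 x ->
  forall j, (nk j.+1 <= n (j + i.+2).+1)%N.
Proof.
move=> mx nx; have /OmD [c ec] : @Om i.+1 x by apply/kerD/cw_maxid2_mulmx0.
have [t nt] : exists t, ~ maxid (c 0 t).
  apply: contrapT => /forallNP h; apply: nx; exists c => // t.
  by apply: contrapT; apply: h.
have hc a : maxid a -> exists y, a *: c = y *m D i.+2.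
  move=> ma; apply/OmD/kerD; rewrite -scalemxAl -ec; apply/rowP => k.
  by rewrite !mxE mulrC; apply: maxid2_maxid_mul.
exact: (@k_summand_leq A hloc nk Omk (fun j => n (j + i.+2)%N)
  (fun j => D (j + i.+2)%N) c t k_res (fun j => @aD (j + i.+2)%N)
  (fun j => @mD (j + i.+2)%N) nt hc).
Qed.

(** * Syzygies satisfying m^2 F = m Omega *)

Section Tower.
Variable i : nat.
Hypothesis mOmegaE : forall x, cw maxid2 x -> @mOmega i.+1 x.

(** The factor m^2 F contributes [r * n i.+1]; the quotient by it is Omega / m Omega, with the rows
    of [D i.+1] as a basis. *)
Lemma clen_syzygyS : clen (fun x => x = 0) (@Om i.+1) (r * n i.+1 + n i.+2).
Proof.
apply: clen_trans (clen_m2_free _) _.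
have sub2 := is_submod_cw (n i.+1) maxid2_submod.
suff -> : @Om i.+1 = fun v => exists x : 'rV[A]_(n i.+2),
    cw maxid2 (v - comb x (fun j => row j (D i.+1))).
  apply: clen_basis => // [x j mx k|x].
    by rewrite !mxE; apply: maxid2_mul => //; apply: mD.
  (* If x D lies in m^2 F, it equals y D with y in m; then x - y is a syzygy, so it has nonunit
     entries and so does x. *)
  rewrite comb_row => /mOmegaE [y my e_xy].
  have /kerD /mOm mxy : (x - y) *m D i.+1 = 0 by rewrite mulmxBl e_xy subrr.
  by move=> j; rewrite -[x](subrK y) mxE; apply: hloc.
apply/predeqP => v; split=> [/OmD [y ->]|[x]].
  by exists y; rewrite comb_row subrr; apply: submod0.
rewrite comb_row => /mOmegaE [y _ ey]; apply/OmD; exists (y + x).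
by rewrite mulmxDl -ey subrK.
Qed.

(** [Om i] is the quotient of the free module of rank [n i.+1] by [Om i.+1], whose length is known;
    the terms in [r] cancel. *)
Lemma clen_syzygy :
  exists2 l, clen (fun x => x = 0) (@Om i) l & (l + n i.+2 = (1 + e) * n i.+1)%N.
Proof.
have [l hl] : exists l, clen (@Om i.+1) (fun _ => True) l.
  apply: clen_between m3 (clen_free _) (hOm _) (is_submodT _) _ _ _ => // v ->.
  exact: submod0.
exists l.
  have := @clen_image _ _ _ (mulmxr (D i)) _ _ _ hl.
  have -> : (fun w => exists2 v, @Om i.+1 v & mulmxr (D i) v = w) = (fun x => x = 0).
    apply/predeqP => w; split=> [[v /kerD <- <-//]|->].
    by exists 0; [apply: submod0|rewrite linear0].
  have -> : (fun w => exists2 v, True & mulmxr (D i) v = w) = @Om i.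
    apply/predeqP => w; split=> [[v _ <-]|/OmD [y ->]]; last by exists y.
    by apply/OmD; exists v.
  by apply=> v _ /kerD.
have := clen_uniq (clen_trans clen_syzygyS hl) (clen_free _).
rewrite !mulnDl mul1n; lia.
Qed.

(** The cone inequality for S = [Om i.+1], where mS = m^2 F is a vector space of dimension
    [r * n i.+1] and S/mS one of dimension [n i.+2]. *)
Lemma betti_cone_leq j :
  (n i.+2 * nk j.+1 <= n (j + i.+2).+1 + kr nk (r * n i.+1) j)%N.
Proof.
have [|g [g2 gen ind]] := clen_get_basis (clen_m2_free (n i.+1)).
  move=> x v mx mv; apply/rowP => k; rewrite !mxE mulrC.
  exact: maxid2_maxid_mul.
have hy k : exists y, cw (@maxid A) y /\ g k = y *m D i.+1.
  by have [y my ey] := mOmegaE (g2 k); exists y.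
have [y ey] := choice hy.
(* The rows of [w] are preimages, with entries in m, of a basis of m^2 F. *)
pose w : 'M[A]_(r * n i.+1, n i.+2) := \matrix_k y k.
have wE z : z *m w *m D i.+1 = comb z g.
  rewrite -mulmxA -comb_row; apply: eq_bigr => k _; congr (_ *: _).
  by rewrite row_mul rowK -(ey k).2.
have [E hE] := k_copies hloc k_res (r * n i.+1).
have [G hG] := k_copies hloc k_res (n i.+2).
apply: (@cone_leq A hloc (fun j => n (j + i.+2)%N) (fun j => D (j + i.+2)%N) _ E _ G w
  (fun j => @aD (j + i.+2)%N) (fun j => @mD (j + i.+2)%N) hE hG) => //.
- by move=> k l; rewrite mxE; apply: (ey k).1.
- move=> z mz; apply/aD; rewrite wE; apply: big1 => k _.
  by apply/rowP => l; rewrite !mxE mulrC; apply: maxid2_maxid_mul => //; apply: g2.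
- move=> z t ez; apply: ind; rewrite -wE ez -mulmxA.
  by rewrite (acyclic_comp i.+1 aD) mulmx0.
- move=> z mz; have [x] := gen _ (cw_maxid2_mulmx mz (@mD i.+1)).
  rewrite -wE -mulmxBl => /aD [t et]; exists t, x.
  by rewrite -et subrK.
Qed.

End Tower.

End ShortRing.

(** * The common divisor *)

(** The function x (e - x) is strictly increasing below e/2. This makes the ratio independent of the
    module. *)
Lemma small_root_uniq (e r a b : nat) : (a * (e - a) = r)%N -> (a < e - a)%N ->
  (b * (e - b) = r)%N -> (b < e - b)%N -> a = b.
Proof.
wlog ab : a b / (a <= b)%N => [h|] ha la hb lb.
  by have [/h|/ltnW /h] := leqP a b => [|h']; [apply|apply/esym/h'].
have [p ep] : exists p, (e = b + (b + p.+1))%N by exists (e - b - b).-1; lia.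
have [d ed] : exists d, b = (a + d)%N by exists (b - a)%N; lia.
subst b e; case: d ab ha la hb lb => [|d] ab ha la hb lb; first by rewrite addn0.
exfalso; move: ha; rewrite -hb.
have -> : (a + d.+1 + (a + d.+1 + p.+1) - a = d.+1 + (a + d.+1 + p.+1))%N by lia.
have -> : (a + d.+1 + (a + d.+1 + p.+1) - (a + d.+1) = a + d.+1 + p.+1)%N by lia.
nia.
Qed.

Theorem theorem8p1 (A : comUnitRingType) :
  artin_local A -> short_ring A -> ~ complete_intersection A ->
  exists bA : nat, (leq 2 bA) /\
    forall (M : lmodType A),
      (exists (m : nat) (g : 'I_m -> M), generates (fun _ => True) (fun x => x = 0) g) ->
      forall (nM : nat -> nat) (OmM : forall i, 'rV[A]_(nM i) -> Prop)
             (nk : nat -> nat) (Omk : forall i, 'rV[A]_(nk i) -> Prop),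
        min_resolution (fun _ : M => True) (fun x => x = 0) OmM ->
        min_resolution (fun _ : A^o => True) (@maxid A) Omk ->
        (curv nM < curv nk)%E ->
        forall i : nat, (leq 1 i) ->
          exists l : nat, has_length (OmM i.-1) l /\ (dvdn bA l).
Proof.
move=> [hloc hlen] [m3 [x1 [y1 [mx1 [my1 xy1]]]]] _.
have [e [r [r0 len_m2 len_m len_A]]] := short_lengths hloc m3 mx1 my1 xy1 hlen.
pose P a := (a * (e - a) = r)%N /\ (a < e - a)%N.
(* If no admissible root exists, the value 2 is arbitrary: every module of smaller curvature then
   has vanishing [u 0], and its syzygies have length 0. *)
have [bA [bA2 bAP]] : exists bA, (2 <= bA)%N /\ forall a, P a -> bA = (1 + e - a)%N.
  have [[a [ra la]]|nP] := pselect (exists a, P a); last first.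
    by exists 2%N; split=> // a Pa; case: nP; exists a.
  exists (1 + e - a)%N; split; first by lia.
  by move=> b [rb lb]; rewrite (small_root_uniq ra la rb lb).
exists bA; split=> // M _ nM OmM nk Omk M_res k_res hcurv i _; move: i.-1 => {}i.
have [x0 [x [c [x00 x0x hb ng]]]] := limn_root_sep hcurv.
have [hOm mOm [D hD]] := min_resolution_complex (is_submod0 M) M_res.
have OmD j := (hD j).1; have kerD j := (hD j).2.
have c0 : 0 <= c by have := hb 0%N; rewrite expr0 mulr1; apply: le_trans.
(* Otherwise k is a summand of a syzygy, and its Betti numbers are bounded by shifted Betti numbers
   of [M], against [ng]; the shift costs the factor [x0 ^+ j.+2]. *)
have full j (z : 'rV[A]_(nM j.+1)) : cw (@maxid2 A) z ->
    exists2 y, cw (@maxid A) y & z = y *m D j.+1.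
  move=> mz; apply: contrapT => nz.
  have le_b := k_summand_betti hloc m3 mOm OmD kerD k_res mz nz.
  apply: (ng (c * x0 ^+ j.+2)) => k.
  apply: (@le_trans _ _ (nM (k + j.+2).+1)%:R); first by rewrite ler_nat.
  apply: le_trans (hb _) _; rewrite -addSn addnC exprD mulrA; apply: ler_wpM2l.
    by apply: mulr_ge0 => //; apply: exprn_ge0; apply: ltW.
  have xp := lt_trans x00 x0x.
  by rewrite lerXn2r ?nnegrE ?(ltW x00) ?(ltW xp) // ltW.
have len j := clen_syzygy hloc m3 len_m2 len_m len_A hOm mOm OmD kerD (full j).
have lenS j := clen_syzygyS hloc len_m2 mOm OmD kerD (full j).
pose u j := nM j.+1; pose g j := if j is j'.+1 then nk j'.+1 else 1%N.
(* Equates the two computations of the length of [OmM j.+1], as a quotient and by its own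
   filtration. *)
have rec j : (u j.+2 + r * u j = e * u j.+1)%N.
  have [l hl el] := len j.+1; have := clen_uniq hl (lenS j).
  by move: el; rewrite /u mulnDl; lia.
have cone j k : (u j.+1 * g k.+1 <= u (k + j).+2 + r * u j * g k)%N.
  have := betti_cone_leq hloc m3 len_m2 mOm OmD kerD k_res (full j) k.
  rewrite /u /g /kr !addnS; case: k => [|k] //; by rewrite muln1.
have ub j : (u j)%:R <= c * x0 * x0 ^+ j by rewrite -mulrA -exprS; apply: hb.
have [l hl el] := len i; exists l; split; first exact: clen_has_length.
(* If [u 0] vanishes, all later Betti numbers do, and the length is 0. *)
have [u0|u0] := pselect (u 0%N = 0%N).
  have uz j : u j = 0%N.
    elim: j => // j IH; have [l' _] := len j.
    by rewrite -/(u j) -/(u j.+1) IH; lia.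
  by move: el; rewrite -/(u i) -/(u i.+1) !uz muln0 addn0 => ->.
have [a [ra la geo]] := ratio_rigid r0 x00 x0x rec cone ub ng u0.
rewrite (bAP a) //.
have -> : l = ((1 + e - a) * u i)%N.
  by move: el; rewrite -/(u i) -/(u i.+1) geo mulnBl; lia.
exact: dvdn_mulr.
Qed.
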